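(* If $D$ is a digraph that contains no necklace as a subdigraph, then the dichromatic number of $D$ is countable.
   Context: Digraphs have no loops and no parallel edges, but may contain both $uv$ and $vu$. For vertex sets $A,B$, an $A$–$B$ path is a directed path meeting $A$ exactly in its first vertex and $B$ exactly in its last vertex. A necklace is a digraph $N$ that is the union of: pairwise disjoint finite vertex sets $Y_0,Y_1,\dots$ (beads) each spanning a strongly connected digraph $H_i$ with $V(H_i)=Y_i$, together with, for each $i$, a $Y_i$–$Y_{i+1}$ path $P_i$ and a $Y_{i+1}$–$Y_i$ path $Q_i$, all these paths internally disjoint from each other and from all beads. A vertex set is acyclic in $D$ if the subdigraph it induces contains no directed cycle. The dichromatic number of $D$ is the least cardinal $\kappa$ such that $V(D)$ can be partitioned into $\kappa$ sets each acyclic in $D$. *)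

(* Defs.v *)
From mathcomp Require Import all_boot.
From mathcomp Require Import boolp classical_sets functions cardinality.

Set Implicit Arguments.
Unset Strict Implicit.
Unset Printing Implicit Defensive.

Local Open Scope classical_set_scope.
Local Open Scope card_scope.

Section Digraphs.
Variable T : Type.

(* The vertex set may be any subset of the ambient type [T], of any
   cardinality, so that a digraph and its subdigraphs live on the same type. *)
Record digraph := Digraph {
  vert : set T;
  edge : set (T * T);
  edge_vert : forall u v, edge (u, v) -> vert u /\ vert v;
  edge_loopless : forall u, ~ edge (u, u)
}.

Definition subdigraph (H D : digraph) : Prop :=
  vert H `<=` vert D /\ edge H `<=` edge D.

Lemma induced_vert (D : digraph) (X : set T) u v :
  (edge D `&` (X `*` X)) (u, v) -> (vert D `&` X) u /\ (vert D `&` X) v.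
Proof. by case=> /edge_vert[Du Dv] [Xu Xv]. Qed.

Lemma induced_loopless (D : digraph) (X : set T) u :
  ~ (edge D `&` (X `*` X)) (u, u).
Proof. by case=> /edge_loopless. Qed.

Definition induced (D : digraph) (X : set T) : digraph :=
  Digraph (@induced_vert D X) (@induced_loopless D X).

(* Only the values of [path_at] at 0, ..., path_len are significant. *)
Record dipath := Dipath {
  path_len : nat;
  path_at : nat -> T;
  path_inj : set_inj `I_path_len.+1 path_at
}.

Definition path_first (p : dipath) : T := path_at p 0.
Definition path_last (p : dipath) : T := path_at p (path_len p).

Definition path_vert (p : dipath) : set T := path_at p @` `I_(path_len p).+1.
Definition path_edge (p : dipath) : set (T * T) :=
  [set (path_at p i, path_at p i.+1) | i in `I_(path_len p)].

Lemma path_edge_vert p u v :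
  path_edge p (u, v) -> path_vert p u /\ path_vert p v.
Proof.
case=> i /= ip [<- <-]; split; first by exists i => //=; exact: ltnW.
by exists i.+1.
Qed.

Lemma path_loopless p u : ~ path_edge p (u, u).
Proof.
case=> i /= ip [<-] /(@path_inj p); rewrite !inE /= !ltnS ip (ltnW ip).
by move=> /(_ isT isT) /esym/n_Sn.
Qed.

Definition path_digraph (p : dipath) : digraph :=
  Digraph (@path_edge_vert p) (@path_loopless p).

Definition path_interior (p : dipath) : set T :=
  path_vert p `\` [set path_first p; path_last p].

Definition AB_path (A B : set T) (p : dipath) : Prop :=
  path_vert p `&` A = [set path_first p] /\
  path_vert p `&` B = [set path_last p].

(* Only the values of [cycle_at] at 0, ..., cycle_len - 1 are significant.
   Length 2 (a pair of opposite edges) is allowed. *)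
Record dicycle := Dicycle {
  cycle_len : nat;
  cycle_at : nat -> T;
  cycle_len_gt1 : 1 < cycle_len;
  cycle_inj : set_inj `I_cycle_len cycle_at
}.

Definition cycle_vert (c : dicycle) : set T := cycle_at c @` `I_(cycle_len c).
Definition cycle_edge (c : dicycle) : set (T * T) :=
  [set (cycle_at c i, cycle_at c (i.+1 %% cycle_len c)) | i in `I_(cycle_len c)].

Lemma cycle_edge_vert c u v :
  cycle_edge c (u, v) -> cycle_vert c u /\ cycle_vert c v.
Proof.
case=> i /= ic [<- <-]; split; first by exists i.
by exists (i.+1 %% cycle_len c) => //=; rewrite ltn_mod (leq_ltn_trans (leq0n i) ic).
Qed.

Lemma cycle_loopless c u : ~ cycle_edge c (u, u).
Proof.
case=> i /= ic [<-] /(@cycle_inj c).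
rewrite !inE /= ltn_mod ic (leq_ltn_trans (leq0n i) ic) => /(_ isT isT) /eqP.
have c1 := cycle_len_gt1 c.
move: ic; rewrite leq_eqVlt => /predU1P[ic|ic]; last first.
  by rewrite modn_small // => /eqP/esym/n_Sn.
by rewrite ic modnn => /eqP i0; move: c1; rewrite -ic -i0.
Qed.

Definition cycle_digraph (c : dicycle) : digraph :=
  Digraph (@cycle_edge_vert c) (@cycle_loopless c).

Definition strongly_connected (H : digraph) : Prop :=
  forall u v, vert H u -> vert H v ->
    exists p : dipath, [/\ path_first p = u, path_last p = v
                         & subdigraph (path_digraph p) H].

(* [H i] are the digraphs spanned by the beads [vert (H i)]; the linking paths
   are [R true i] (forwards, P_i) and [R false i] (backwards, Q_i). *)
Definition necklace (N : digraph) : Prop :=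
  exists (H : nat -> digraph) (R : bool -> nat -> dipath),
    [/\ (forall i, finite_set (vert (H i)) /\ strongly_connected (H i)),
        (forall i j, i <> j -> vert (H i) `&` vert (H j) = set0),
        (forall i, AB_path (vert (H i)) (vert (H i.+1)) (R true i) /\
                   AB_path (vert (H i.+1)) (vert (H i)) (R false i)),
        (forall b i, (forall j, path_interior (R b i) `&` vert (H j) = set0) /\
           (forall c j, (b, i) <> (c, j) ->
              path_interior (R b i) `&` path_vert (R c j) = set0)) &
        vert N = \bigcup_i (vert (H i) `|` path_vert (R true i)
                                       `|` path_vert (R false i)) /\
        edge N = \bigcup_i (edge (H i) `|` path_edge (R true i)
                                       `|` path_edge (R false i))].

Definition acyclic (D : digraph) (X : set T) : Prop :=
  ~ exists c : dicycle, subdigraph (cycle_digraph c) (induced D X).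

Definition acyclic_partition (D : digraph) (P : set (set T)) : Prop :=
  partition P id (vert D) /\ forall X, P X -> acyclic D X.

(* The cardinal kappa is represented by any set [K] of that cardinality. *)
Definition is_dichromatic_number (D : digraph) (U : Type) (K : set U) : Prop :=
  (exists P, acyclic_partition D P /\ P #= K) /\
  (forall P, acyclic_partition D P -> K #<= P).

End Digraphs.

(* Main.v *)
Require Import Defs.
From mathcomp Require Import all_boot.
From mathcomp Require Import boolp classical_sets functions cardinality.
From mathcomp Require Import zify.

(** Call a vertex set uncolorable if it is not a union of countably many acyclic
sets. Every directed cycle avoiding a finite set [F] lies in one strong component
of [X - F], so if [X] is uncolorable then so is some strong component of [X - F].
If [D] is uncolorable this gives a decreasing sequence of strong uncolorable
regions [C_i]: choose a finite strong bead [Y_i] in [C_i] and let [C_(i+1)] be an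
uncolorable strong component of [C_i - Y_i]. As [C_i] is strong, [Y_i] and
[C_(i+1)] are linked in both directions inside [C_i], disjointly after enlarging
[Y_i]; letting [Y_(i+1)] contain the ends of these links in [C_(i+1)] yields a
necklace. *)

Set Implicit Arguments.
Unset Strict Implicit.
Unset Printing Implicit Defensive.

Local Open Scope classical_set_scope.
Local Open Scope card_scope.

Lemma ex_least (P : nat -> Prop) :
  (exists n, P n) -> exists n, P n /\ forall m, P m -> n <= m.
Proof.
move=> exP; have exP' : exists n, `[< P n >] by case: exP => n /asboolP; exists n.
case: (ex_minnP exP') => n /asboolP Pn minn; exists n; split=> // m Pm.
by apply: minn; apply/asboolP.
Qed.

(** * Walks, links and reachability inside a vertex set *)

Section Walks.
Variables (T : Type) (D : digraph T).
Implicit Types (X Y Z A B C F : set T) (w v : nat -> T) (x y z : T).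

(* Only the values of [w] at 0, ..., n are significant. *)
Definition walk X n w : Prop :=
  (forall i, i <= n -> X (w i)) /\ (forall i, i < n -> edge D (w i, w i.+1)).

Definition link A B X n w : Prop := [/\ walk X n w, A (w 0) & B (w n)].

Definition reach X x y : Prop := exists n w, link [set x] [set y] X n w.

Definition strong X : Prop := forall x y, X x -> X y -> reach X x y.

Definition strong_component X x : set T := [set y | reach X x y /\ reach X y x].

Lemma walk_sub X Y n w : X `<=` Y -> walk X n w -> walk Y n w.
Proof. by move=> XY [Xw Ew]; split=> // i /Xw/XY. Qed.

Lemma walk_take X n w i : i <= n -> walk X n w -> walk X i w.
Proof.
move=> in_ [Xw Ew]; split=> j ji; first by apply: Xw; lia.
by apply: Ew; lia.
Qed.

Lemma walk_drop X n w i :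
  i <= n -> walk X n w -> walk X (n - i) (fun k => w (i + k)).
Proof.
move=> in_ [Xw Ew]; split=> j ji; first by apply: Xw; lia.
by rewrite addnS; apply: Ew; lia.
Qed.

(** The junction vertex is counted once: index [n] reads [w n], and [v] takes over from [v 1]. *)
Definition cat_walk n w v := fun k => if k <= n then w k else v (k - n).

Lemma cat_walk_last n w m v : w n = v 0 -> cat_walk n w v (n + m) = v m.
Proof.
move=> wv; rewrite /cat_walk; case: leqP => [nm|_]; last by rewrite addKn.
have -> : m = 0 by lia.
by rewrite addn0.
Qed.

Lemma walk_cat X n w m v : w n = v 0 -> walk X n w -> walk X m v ->
  walk X (n + m) (cat_walk n w v).
Proof.
move=> wv [Xw Ew] [Xv Ev]; rewrite /cat_walk; split=> i inm.
  by case: leqP => ni; [apply: Xw | apply: Xv; lia].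
case: (ltngtP i n) => ni.
- exact: Ew.
- by rewrite subSn; [apply: Ev; lia | lia].
- by rewrite ni wv subSnn; apply: Ev; lia.
Qed.

Lemma reach_refl X x : X x -> reach X x x.
Proof. by move=> Xx; exists 0, (fun=> x); split=> //; split. Qed.

Lemma reach_trans X x y z : reach X x y -> reach X y z -> reach X x z.
Proof.
move=> [n [w [Ww w0 wn]]] [m [v [Wv v0 vm]]].
have wv : w n = v 0 by rewrite wn v0.
exists (n + m), (cat_walk n w v); split=> //; first exact: walk_cat.
by rewrite cat_walk_last.
Qed.

Lemma reach_sub X Y x y : X `<=` Y -> reach X x y -> reach Y x y.
Proof.
by move=> XY [n [w [Ww w0 wn]]]; exists n, w; split=> //; exact: walk_sub Ww.
Qed.

Lemma walk_reach X n w i j : walk X n w -> i <= j -> j <= n ->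
  reach X (w i) (w j).
Proof.
move=> Ww ij jn; exists (j - i), (fun k => w (i + k)); split.
- by apply: walk_drop => //; exact: walk_take Ww.
- by rewrite /= addn0.
- by rewrite /= subnKC.
Qed.

(** * Shortest links as directed paths *)

(** Cutting out the piece between two equal vertices, dropping what precedes a later vertex of [A],
    or dropping what follows an earlier vertex of [B] would each leave a shorter link. *)
Lemma shortest_link A B X n w : link A B X n w ->
  (forall m v, link A B X m v -> n <= m) ->
  [/\ set_inj `I_n.+1 w,
      forall i, i <= n -> A (w i) -> i = 0
    & forall i, i <= n -> B (w i) -> i = n].
Proof.
move=> [Ww Aw Bw] minn.
have cut i j : i < j -> j <= n -> w i <> w j.
  move=> ij jn wij.
  have := minn (i + (n - j)) (cat_walk i w (fun k => w (j + k))).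
  suff H : link A B X (i + (n - j)) (cat_walk i w (fun k => w (j + k))).
    by move=> /(_ H); lia.
  split=> //.
  - apply: walk_cat; first by rewrite addn0.
      by apply: walk_take Ww; lia.
    exact: walk_drop.
  - by rewrite cat_walk_last ?addn0 // subnKC.
split=> [i j|i in_ Ai|i in_ Bi].
- rewrite !inE /= => ni nj wij; case: (ltngtP i j) => // ij.
    by case: (cut i j).
  by case: (cut j i) => //.
- have := minn (n - i) (fun k => w (i + k)).
  suff H : link A B X (n - i) (fun k => w (i + k)) by move=> /(_ H); lia.
  by split; [exact: walk_drop | rewrite addn0 | rewrite subnKC].
- have := minn i w.
  suff H : link A B X i w by move=> /(_ H); lia.
  by split=> //; exact: walk_take Ww.
Qed.

Lemma path_interiorP (p : dipath T) x : path_interior p x ->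
  exists2 i, 0 < i < path_len p & path_at p i = x.
Proof.
case=> -[i /= ip <-] /not_orP[]; rewrite /path_first /path_last /= => i0 i_n.
exists i => //; apply/andP; split; first by case: i i0 {ip i_n}.
by move: ip; rewrite ltnS leq_eqVlt => /predU1P[ip|//]; rewrite ip in i_n.
Qed.

Lemma shortest_AB_path A B n w (w_inj : set_inj `I_n.+1 w) :
  A (w 0) -> B (w n) -> (forall i, i <= n -> A (w i) -> i = 0) ->
  (forall i, i <= n -> B (w i) -> i = n) -> AB_path A B (Dipath w_inj).
Proof.
move=> A0 Bn Aw Bw; split; apply/seteqP; split=> x.
- by case=> -[i /= ni <-] /Aw ->.
- by move=> ->; split=> //; exists 0.
- by case=> -[i /= ni <-] /Bw ->.
- by move=> ->; split=> //; exists n => /=.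
Qed.

Lemma walk_dipath_sub X n w (w_inj : set_inj `I_n.+1 w) :
  X `<=` vert D -> walk X n w ->
  subdigraph (path_digraph (Dipath w_inj)) (induced D X).
Proof.
move=> XD [Xw Ew]; split=> [x|[x y]] /=.
  by case=> i /= ni <-; split; [apply: XD|]; apply: Xw; lia.
case=> i /= ni [<- <-]; split; first exact: Ew.
by split; apply: Xw; lia.
Qed.

(** * Strong sets and ears *)

Lemma strong_connected X :
  X `<=` vert D -> strong X -> strongly_connected (induced D X).
Proof.
move=> XD sX x y [_ Xx] [_ Xy].
have [n [[w Lw] minn]] := ex_least (sX x y Xx Xy).
have [w_inj _ _] := shortest_link Lw (fun m v Lv => minn m (ex_intro _ v Lv)).
case: Lw => Ww w0 wn; exists (Dipath w_inj); split=> //.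
exact: walk_dipath_sub.
Qed.

(** The vertex [w 0] serves as a hub: [w] leads from it to each point of the ear, and from there on
    to [w n], whence [Y] leads back to [w 0]. *)
Lemma strong_ear Y n w : strong Y -> Y (w 0) -> Y (w n) ->
  (forall i, i < n -> edge D (w i, w i.+1)) -> strong (Y `|` w @` `I_n.+1).
Proof.
move=> sY Y0 Yn Ew; set Z := Y `|` _.
have YZ : Y `<=` Z by move=> x; left.
have Ww : walk Z n w by split=> // i ni; right; exists i.
have to0 x : Z x -> reach Z x (w 0) /\ reach Z (w 0) x.
  case=> [Yx|[i /= ni <-]]; first by split; apply: (reach_sub YZ); exact: sY.
  split; last exact: walk_reach Ww _ _.
  apply: (@reach_trans _ _ (w n)); first exact: walk_reach Ww _ _.
  by apply: (reach_sub YZ); exact: sY.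
by move=> x y /to0[x0 _] /to0[_ y0]; exact: reach_trans y0.
Qed.

Lemma ear_sub X Y n w : Y `<=` X -> walk X n w -> Y `|` w @` `I_n.+1 `<=` X.
Proof. by move=> YX [Xw _] x [/YX//|[i /= ni <-]]; exact: Xw. Qed.

Lemma finite_ear Y n w : finite_set Y -> finite_set (Y `|` w @` `I_n.+1).
Proof. by move=> fY; rewrite finite_setU; split=> //; exact: finite_image. Qed.

(** A walk from [a] to [b] followed by one back is an ear attached to the single vertex [a]. *)
Lemma finite_strong_hull X a b : strong X -> X a -> X b ->
  exists Y, [/\ finite_set Y, strong Y, Y `<=` X, Y a & Y b].
Proof.
move=> sX Xa Xb.
have [n [w [Ww w0 wn]]] := sX a b Xa Xb.
have [m [v [Wv v0 vm]]] := sX b a Xb Xa.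
have wv : w n = v 0 by rewrite wn v0.
have Wwv := walk_cat wv Ww Wv.
exists ([set a] `|` cat_walk n w v @` `I_(n + m).+1); split.
- exact/finite_ear/finite_set1.
- apply: strong_ear => //; last by case: Wwv.
    by move=> _ _ -> ->; exact: reach_refl.
  by rewrite cat_walk_last.
- by apply: ear_sub => // _ ->.
- by left.
- by right; exists n; [rewrite /=; lia | rewrite /cat_walk leqnn].
Qed.

(** * Strong components *)

Lemma strong_component_sub X x : strong_component X x `<=` X.
Proof. by move=> y [[n [w [[Xw _] _ /= <-]]] _]; exact: Xw. Qed.

(** A walk in [X] between two vertices of the component never leaves it, as each of its vertices is
    reached from [x] and reaches [x]. *)
Lemma strong_component_strong X x : strong (strong_component X x).
Proof.
move=> y z [xy yx] [xz zx].
have [n [w [Ww w0 wn]]] := reach_trans yx xz.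
exists n, w; split=> //; split; last by case: Ww.
move=> i ni; split.
  by apply: (reach_trans xy); rewrite -w0; exact: walk_reach Ww _ _.
by apply: reach_trans zx; rewrite -wn; exact: walk_reach Ww _ _.
Qed.

Lemma strong_component_eq X x y :
  strong_component X x y -> strong_component X y = strong_component X x.
Proof.
move=> [xy yx]; apply/seteqP; split=> z [h1 h2]; split.
- exact: reach_trans h1.
- exact: reach_trans yx.
- exact: reach_trans h1.
- exact: reach_trans xy.
Qed.

(** * Colouring by strong components *)

Lemma cycle_at_vert (c : dicycle T) i :
  i < cycle_len c -> cycle_vert c (cycle_at c i).
Proof. by exists i. Qed.

Lemma cycle_reach X (c : dicycle T) i j :
  subdigraph (cycle_digraph c) (induced D X) ->
  i < cycle_len c -> j < cycle_len c -> reach X (cycle_at c i) (cycle_at c j).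
Proof.
move=> [cV cE] ic jc.
(* The extra full turn keeps the subtraction exact when [j < i]. *)
exists (cycle_len c + j - i), (fun k => cycle_at c ((i + k) %% cycle_len c)).
have c0 : 0 < cycle_len c by lia.
split.
- split=> k kn.
    by have [] := cV _ (cycle_at_vert (ltn_pmod (i + k) c0)).
  suff : cycle_edge c (cycle_at c ((i + k) %% cycle_len c),
                      cycle_at c ((i + k.+1) %% cycle_len c)).
    by move=> /cE[].
  exists ((i + k) %% cycle_len c); first exact: ltn_pmod.
  by rewrite -addn1 modnDml addn1 addnS.
- by rewrite /= addn0 modn_small.
- by rewrite /= subnKC; [rewrite modnDl modn_small | lia].
Qed.

Definition colorable X : Prop :=
  exists f : T -> nat, forall k, acyclic D (X `&` f @^-1` [set k]).

(* A directed cycle avoiding [F] stays in one strong component of [X `\` F], so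
   the components may reuse the odd colours while [F] takes the even ones. *)
Lemma colorable_components X F : finite_set F ->
  (forall x, (X `\` F) x -> colorable (strong_component (X `\` F) x)) ->
  colorable X.
Proof.
move=> finF colC.
have [h h_inj] := elimT (countable_injP F) (finite_set_countable finF).
(* The colouring is chosen per component as a set, so all vertices of one component use the same
   one; the zero function is a default for uncolorable sets. *)
have [g gP] : {g : set T -> T -> nat & forall C, colorable C ->
    forall k, acyclic D (C `&` g C @^-1` [set k])}.
  apply: (@choice _ _ (fun C (f : T -> nat) => colorable C ->
    forall k, acyclic D (C `&` f @^-1` [set k]))) => C.
  by have [[f Cf]|nC] := pselect (colorable C); [exists f | exists (fun=> 0)].
pose SC := strong_component (X `\` F).
pose f x := if `[< F x >] then (h x).*2 else (g (SC x) x).*2.+1.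
have fF x : F x -> f x = (h x).*2 by move=> Fx; rewrite /f asboolT.
have fN x : ~ F x -> f x = (g (SC x) x).*2.+1 by move=> nFx; rewrite /f asboolF.
exists f => k [c [cV cE]].
have c1 := cycle_len_gt1 c.
have cX i : i < cycle_len c -> X (cycle_at c i) /\ f (cycle_at c i) = k.
  by move=> /cycle_at_vert/cV[_ []].
have [_ f0] := cX 0 (ltnW c1); have [_ f1] := cX 1 c1.
(* If the cycle starts in [F], parity of the colours puts its second vertex in [F] as well, and
   injectivity of [h] identifies the two. *)
have [F0|nF0] := pselect (F (cycle_at c 0)).
  have F1 : F (cycle_at c 1).
    by apply: contrapT => nF1; move: f0; rewrite -f1 (fF _ F0) (fN _ nF1); lia.
  have /h_inj : h (cycle_at c 0) = h (cycle_at c 1).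
    by move: f0; rewrite -f1 (fF _ F0) (fF _ F1); lia.
  rewrite !inE => /(_ F0 F1) /cycle_inj; rewrite !inE /= => H.
  by have := H (ltnW c1) c1.
have cXF i : i < cycle_len c -> (X `\` F) (cycle_at c i).
  move=> /cX[Xi fi]; split=> // Fi.
  by move: f0; rewrite -fi (fF _ Fi) (fN _ nF0); lia.
have cXFsub : subdigraph (cycle_digraph c) (induced D (X `\` F)).
  split=> [x cx|[x y] cxy].
    by have [Dx _] := cV x cx; split=> //; case: cx => i ic <-; exact: cXF.
  have [Exy _] := cE _ cxy; split=> //.
  by have [[i ic <-] [j jc <-]] := cycle_edge_vert cxy; split; exact: cXF.
have cSC i : i < cycle_len c -> SC (cycle_at c 0) (cycle_at c i).
  by move=> ic; split; apply: cycle_reach => //; lia.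
have cg i : i < cycle_len c ->
    (SC (cycle_at c 0) `&` g (SC (cycle_at c 0)) @^-1`
       [set g (SC (cycle_at c 0)) (cycle_at c 0)]) (cycle_at c i).
  move=> ic; split; first exact: cSC.
  have [_] := cX i ic; have [_ nFi] := cXF i ic.
  rewrite -f0 (fN _ nFi) (fN _ nF0) {1}/SC.
  rewrite (strong_component_eq (cSC i ic)) -/SC.
  by move=> gE; rewrite /=; lia.
apply: (gP (SC (cycle_at c 0)) (colC _ (cXF _ (ltnW c1)))
  (g (SC (cycle_at c 0)) (cycle_at c 0))); exists c.
split=> [x cx|[x y] cxy].
  by have [Dx _] := cV x cx; split=> //; case: cx => i ic <-; exact: cg.
have [Exy _] := cE _ cxy; split=> //.
by have [[i ic <-] [j jc <-]] := cycle_edge_vert cxy; split; exact: cg.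
Qed.

(** * Internally disjoint links *)

(* Among all beads [Y] containing [Y0] and all pairs of opposite links between
   [Y] and [C'], one of least total length is internally disjoint: at a common
   interior vertex both links could be cut and the removed pieces, which form an
   ear of [Y], moved into the bead. *)
Lemma disjoint_links C C' Y0 : C `<=` vert D -> strong C ->
  C' `<=` C -> C' !=set0 ->
  [/\ finite_set Y0, strong Y0, Y0 `<=` C, Y0 !=set0 & Y0 `&` C' = set0] ->
  exists Y (p q : dipath T),
    [/\ [/\ finite_set Y, strong Y, Y0 `<=` Y, Y `<=` C & Y `&` C' = set0],
        AB_path Y C' p /\ AB_path C' Y q,
        subdigraph (path_digraph p) (induced D C) /\
        subdigraph (path_digraph q) (induced D C)
      & path_interior p `&` path_vert q = set0 /\
        path_interior q `&` path_vert p = set0].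
Proof.
move=> CD sC C'C [c C'c] [fY0 sY0 Y0C [y Y0y] Y0C'].
pose bead Y :=
  [/\ finite_set Y, strong Y, Y0 `<=` Y, Y `<=` C & Y `&` C' = set0].
pose linked k := exists Y n p m q,
  [/\ bead Y, link Y C' C n p, link C' Y C m q & k = n + m].
have [|k [[Y [n [p [m [q [bY Lp Lq kE]]]]]] kmin]] := @ex_least linked.
  have [n [p [Wp p0 pn]]] := sC _ _ (Y0C _ Y0y) (C'C _ C'c).
  have [m [q [Wq q0 qm]]] := sC _ _ (C'C _ C'c) (Y0C _ Y0y).
  exists (n + m), Y0, n, p, m, q; split=> //; split=> //.
  - by rewrite p0.
  - by rewrite pn.
  - by rewrite q0.
  - by rewrite qm.
have [|p_inj pY pC'] := shortest_link Lp.
  move=> n' p' Lp'; have /kmin : linked (n' + m) by exists Y, n', p', m, q.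
  lia.
have [|q_inj qC' qY] := shortest_link Lq.
  move=> m' q' Lq'; have /kmin : linked (n + m') by exists Y, n, p, m', q'.
  lia.
have [fY sY Y0Y YC YC'] := bY.
have [Wp Yp0 C'pn] := Lp; have [Wq C'q0 Yqm] := Lq.
have meet i j : 0 < i < n -> 0 < j < m -> p i <> q j.
  move=> /andP[i0 in_] /andP[j0 jm] pq.
  (* The ear leaves [Y] along [p] up to the common vertex and returns along the rest of [q]. *)
  pose r := cat_walk i p (fun l => q (j + l)).
  have Wr : walk C (i + (m - j)) r.
    apply: walk_cat; first by rewrite addn0.
      by apply: walk_take Wp; lia.
    by apply: walk_drop => //; lia.
  (* What remains are the end of [p] and the start of [q], now attached to the enlarged bead at the
     common vertex; the total drops since [0 < i] and [j < m]. *)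
  suff /kmin : linked ((n - i) + j) by lia.
  exists (Y `|` r @` `I_(i + (m - j)).+1), (n - i), (fun l => p (i + l)), j, q.
  have ri : r i = p i by rewrite /r /cat_walk leqnn.
  split=> //.
  - split.
    + exact: finite_ear.
    + apply: strong_ear => //; last by case: Wr.
      by rewrite /r cat_walk_last ?addn0 // subnKC //; lia.
    + by move=> x /Y0Y; left.
    + exact: ear_sub.
    + apply/seteqP; split=> // x [[Yx C'x|]]; first by rewrite -YC'; split.
      case=> l /= lim <-; rewrite /r /cat_walk; case: leqP => li.
        by move=> /pC'; lia.
      by move=> /qC'; lia.
  - split; first by apply: walk_drop => //; lia.
      by right; exists i; [rewrite /=; lia | rewrite addn0].
    by rewrite subnKC //; lia.
  - split=> //; first by apply: walk_take Wq; lia.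
    by right; exists i; [rewrite /=; lia | rewrite ri].
exists Y, (Dipath p_inj), (Dipath q_inj); split=> //.
- by split; exact: shortest_AB_path.
- by split; exact: walk_dipath_sub.
(* The ends of either path lie in [Y] and [C'], which the other path meets only in its own ends, so
   [meet] covers all remaining cases. *)
- split; apply/seteqP; split=> // x.
    case=> /path_interiorP[i /= /andP[i0 i_n] <-] [j /= mj /esym pq].
    apply: (meet i j) => //; first lia.
    have [jm|jm] := eqVneq j m.
      by have := pY i; rewrite pq jm => /(_ (ltnW i_n) Yqm); lia.
    have [j0|j0] := posnP j; last lia.
    by have := pC' i; rewrite pq j0 => /(_ (ltnW i_n) C'q0); lia.
  case=> /path_interiorP[j /= /andP[j0 j_m] <-] [i /= ni pq].
  apply: (meet i j) => //; last lia.
  have [i_n|i_n] := eqVneq i n.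
    by have := qC' j; rewrite -pq i_n => /(_ (ltnW j_m) C'pn); lia.
  have [i0|i0] := posnP i; last lia.
  by have := qY j; rewrite -pq i0 => /(_ (ltnW j_m) Yp0); lia.
Qed.

(** * One step of the construction *)

(* One step of the construction: [C] is the current region, [Y] the bead chosen
   in it, [C'] the next region and [R] the two links from [Y] to [C'] and back. *)
Definition bead_step C Y C' (R : bool -> dipath T) : Prop :=
  [/\ [/\ finite_set Y, strong Y & Y `<=` C], C' `<=` C /\ Y `&` C' = set0,
      AB_path Y C' (R true) /\ AB_path C' Y (R false),
      forall b, subdigraph (path_digraph (R b)) (induced D C)
    & forall b, path_interior (R b) `&` path_vert (R (~~ b)) = set0].

Definition uncolorable_region C : Prop :=
  [/\ C `<=` vert D, strong C & ~ colorable C].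

Lemma uncolorable_component X F :
  X `<=` vert D -> ~ colorable X -> finite_set F ->
  exists2 C, uncolorable_region C & C `<=` X `\` F.
Proof.
move=> XD nX finF; apply: contrapT => noC; apply: nX.
apply: (colorable_components finF) => x XFx; apply: contrapT => nC.
have CXF := @strong_component_sub (X `\` F) x.
apply: noC; exists (strong_component (X `\` F) x) => //; split=> //.
  by move=> y /CXF[/XD].
exact: strong_component_strong.
Qed.

Lemma colorable0 : colorable set0.
Proof.
exists (fun=> 0) => k [c [cV _]].
by have [_ []] := cV _ (cycle_at_vert (ltnW (cycle_len_gt1 c))).
Qed.

Lemma uncolorable_nonempty C : ~ colorable C -> C !=set0.
Proof.
move=> nC; apply: contrapT => C0; apply: nC.
suff -> : C = set0 by exact: colorable0.
by apply/seteqP; split=> // x Cx; apply: C0; exists x.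
Qed.

(** The vertices [a] and [b] stand for the ends of the two incoming links. A core through them is
    fixed first and the next region chosen off it; [disjoint_links] then enlarges the core without
    touching that region. *)
Lemma bead_step_exists C a b : uncolorable_region C -> C a -> C b ->
  exists Y C' R,
    [/\ bead_step C Y C' R, uncolorable_region C', Y a & Y b].
Proof.
move=> [CD sC nC] Ca Cb.
have [Y0 [fY0 sY0 Y0C Y0a Y0b]] := finite_strong_hull sC Ca Cb.
have [C' rC' C'CY] := uncolorable_component CD nC fY0.
have C'C : C' `<=` C by move=> x /C'CY[].
have C'0 : C' !=set0 by case: rC' => _ _ /uncolorable_nonempty.
have [|Y [p [q [[fY sY Y0Y YC YC'] pq [pC qC] [pq0 qp0]]]]] :=
  disjoint_links CD sC C'C C'0 (Y0 := Y0).
  split=> //; first by exists a.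
  by apply/seteqP; split=> // x [Y0x /C'CY[]].
exists Y, C', (fun e => if e then p else q); split=> //; try exact: Y0Y.
by split=> //; case.
Qed.

(** * Assembling the necklace *)

(** The links run between [Y i] and the region [C i.+1]; as their ends there lie in [Y i.+1], they
    are also paths between consecutive beads. Disjointness comes from the regions decreasing: the
    interior of [R i b] lies in [C i] but off [Y i] and [C i.+1]. *)
Lemma necklace_of_beads (C Y : nat -> set T) (R : nat -> bool -> dipath T) :
  C 0 `<=` vert D ->
  (forall i, bead_step (C i) (Y i) (C i.+1) (R i)) ->
  (forall i, Y i.+1 (path_last (R i true)) /\ Y i.+1 (path_first (R i false))) ->
  exists N, necklace N /\ subdigraph N D.
Proof.
move=> C0D step ends.
have CS i : C i.+1 `<=` C i by case: (step i) => _ [].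
have Cle i j : i <= j -> C j `<=` C i.
  elim: j => [|j IH]; first by rewrite leqn0 => /eqP ->.
  rewrite leq_eqVlt => /predU1P[->//|/IH CC]; exact: subset_trans CC.
have CD i : C i `<=` vert D by exact: subset_trans (Cle 0 i _) C0D.
have YC i : Y i `<=` C i by case: (step i) => -[].
have YCn i j x : i < j -> Y i x -> ~ C j x.
  move=> ij Yx Cx; have [_ [_ Y0] _ _ _] := step i.
  have : (Y i `&` C i.+1) x by split=> //; exact: Cle Cx.
  by rewrite Y0.
have YD i : Y i `<=` vert D by exact: subset_trans (YC i) (CD i).
have YE i : vert (induced D (Y i)) = Y i.
  by apply/seteqP; split=> [x []//|x Yx]; split=> //; exact: YD Yx.
have RC i b : path_vert (R i b) `<=` C i.
  by case: (step i) => _ _ _ /(_ b)[RV _] _ x /RV[].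
have RE i b : path_edge (R i b) `<=` edge D.
  by case: (step i) => _ _ _ /(_ b)[_ RE] _ x /RE[].
have intC i b x : path_interior (R i b) x -> ~ C i.+1 x.
  case: (step i) => _ _ [[_ pC] [qC _]] _ _ [Rx nx] Cx; apply: nx.
  case: b Rx => Rx; [right; rewrite -pC | left; rewrite -qC]; by split.
have RY i b x : path_vert (R i b) x -> C i.+1 x -> Y i.+1 x.
  case: (step i) => _ _ [[_ pC] [qC _]] _ _ Rx Cx; case: (ends i) => Yl Yf.
  case: b Rx => Rx.
    by have : (path_vert (R i true) `&` C i.+1) x by []; rewrite pC => ->.
  by have : (path_vert (R i false) `&` C i.+1) x by []; rewrite qC => ->.
have intY i b j x : path_interior (R i b) x -> ~ Y j x.
  move=> Ix Yx; have Cx := RC _ _ _ Ix.1.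
  (* Earlier beads miss [C i], later ones lie in [C i.+1], and [Y i] meets the link only in an
     end. *)
  have [ji|ij|ji] := ltngtP j i.
  - exact: YCn ji Yx Cx.
  - by apply: (intC _ _ _ Ix); apply: Cle (YC _ _ Yx).
  rewrite ji in Yx; case: (step i) => _ _ [[pY _] [_ qY]] _ _; case: Ix => Rx nx.
  apply: nx; case: b Rx => Rx; [left; rewrite -pY | right; rewrite -qY]; by split.
pose V := \bigcup_i (vert (induced D (Y i)) `|` path_vert (R i true)
                                            `|` path_vert (R i false)).
pose E := \bigcup_i (edge (induced D (Y i)) `|` path_edge (R i true)
                                            `|` path_edge (R i false)).
have ED : E `<=` edge D.
  by move=> e [i _ [[[]//|]|]]; exact: RE.
have EV (u v : T) : E (u, v) -> V u /\ V v.
  case=> i _ [[H|H]|H].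
  - by have [? ?] := edge_vert H; split; exists i => //; left; left.
  - by have [? ?] := path_edge_vert H; split; exists i => //; left; right.
  - by have [? ?] := path_edge_vert H; split; exists i => //; right.
have EL u : ~ E (u, u) by move=> H; exact: edge_loopless (ED _ H).
exists (Digraph EV EL); split; last first.
  split=> //= x [i _ [[[]//|]|]] /RC; exact: CD.
exists (fun i => induced D (Y i)), (fun b i => R i b); split=> //.
- move=> i; rewrite YE; case: (step i) => -[fY sY _] _ _ _ _; split=> //.
  by apply: strong_connected => //; exact: YD.
- move=> i j ij; rewrite !YE; apply/seteqP; split=> // x [Yi Yj].
  have [lij|lji|//] := ltngtP i j.
    exact: YCn lij Yi (YC _ _ Yj).
  exact: YCn lji Yj (YC _ _ Yi).
- move=> i; rewrite !YE; case: (step i) => _ _ [[pY pC] [qC qY]] _ _.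
  have [Yl Yf] := ends i; split; split=> //; apply/seteqP; split=> x.
  + by case=> Rx /YC Cx; rewrite -pC; split.
  + by move=> ->; split=> //; exists (path_len (R i true)) => /=.
  + by case=> Rx /YC Cx; rewrite -qC; split.
  + by move=> ->; split=> //; exists 0.
- move=> b i; split=> [j|c j bicj].
    by rewrite YE; apply/seteqP; split=> // x [Ix] /(intY _ _ _ _ Ix).
  apply/seteqP; split=> // x [Ix Rx].
  (* A later link lies in [C i.+1]; an earlier one meets [C i] only inside the bead [Y j.+1]; for
     equal indices only the opposite link is left. *)
  have [ij|ji|ij] := ltngtP i j.
  + by apply: (intC _ _ _ Ix); apply: (Cle _ j) => //; exact: RC Rx.
  + apply: (intY _ _ j.+1 _ Ix); apply: RY Rx _; apply: (Cle _ i) => //.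
    exact: RC Ix.1.
  + have cb : c = ~~ b.
      by move: bicj; rewrite ij; case: b {Ix}; case: c {Rx}.
    case: (step i) => _ _ _ _ /(_ b) bb0.
    by have : (path_interior (R i b) `&` path_vert (R i (~~ b))) x;
      [split=> //; rewrite -cb ij | rewrite bb0].
Qed.

Lemma uncolorable_necklace :
  ~ colorable (vert D) -> exists N, necklace N /\ subdigraph N D.
Proof.
move=> nD.
(* A state is a region with two marked vertices, the ends of the links entering it, which the next
   bead has to contain. *)
pose state := {s : set T * T * T |
  [/\ uncolorable_region s.1.1, s.1.1 s.1.2 & s.1.1 s.2]}.
pose next (s : state) (t : set T * (bool -> dipath T) * state) :=
  [/\ bead_step (sval s).1.1 t.1.1 (sval t.2).1.1 t.1.2,
      t.1.1 (sval s).1.2 /\ t.1.1 (sval s).2,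
      (sval t.2).1.2 = path_last (t.1.2 true)
    & (sval t.2).2 = path_first (t.1.2 false)].
have [f fP] : {f & forall s, next s (f s)}.
  apply: choice => -[[[C a] b] /= [rC Ca Cb]].
  have [Y [C' [R [st rC' Ya Yb]]]] := bead_step_exists rC Ca Cb.
  have [_ _ [[_ pC] [qC _]] _ _] := st.
  have C'l : C' (path_last (R true)).
    by have [] : (path_vert (R true) `&` C') (path_last (R true)) by rewrite pC.
  have C'f : C' (path_first (R false)).
    by have [] : (path_vert (R false) `&` C') (path_first (R false)) by rewrite qC.
  pose s' : state := exist _ (C', path_last (R true), path_first (R false))
    (And3 rC' C'l C'f).
  by exists (Y, R, s'); split.
(* [D] need not be strong, so the first region is a component obtained by deleting nothing. *)
have [C0 rC0 _] :=
  uncolorable_component (@subset_refl _ (vert D)) nD (@finite_set0 T).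
have [a C0a] : C0 !=set0 by case: rC0 => _ _ /uncolorable_nonempty.
(* No link enters the first region; an arbitrary vertex is marked twice. *)
pose s0 : state := exist _ (C0, a, a) (And3 rC0 C0a C0a).
pose s i := iter i (fun s => (f s).2) s0.
apply: (@necklace_of_beads (fun i => (sval (s i)).1.1) (fun i => (f (s i)).1.1)
  (fun i => (f (s i)).1.2)) => [|i|i].
- by have [] := rC0.
- by case: (fP (s i)).
- case: (fP (s i)) => _ _ <- <-; by case: (fP (s i.+1)).
Qed.

(** * From colourings to the dichromatic number *)

Lemma colorable_partition : colorable (vert D) ->
  exists2 P, acyclic_partition D P & countable P.
Proof.
case=> f fP; pose K k := vert D `&` f @^-1` [set k].
(* Blocks of a partition are nonempty, so empty colour classes are dropped. *)
exists [set X | X !=set0 /\ exists k, X = K k].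
  split; last by move=> _ [_ [k ->]]; exact: fP.
  split.
  - apply/seteqP; split=> [x [_ [_ [k ->]] []]//|x Dx].
    by exists (K (f x)) => //; split; [exists x | exists (f x)].
  - by move=> _ _ [_ [k ->]] [_ [l ->]] [x [[_ <-] [_ <-]]].
  - by move=> X [].
apply: (@sub_countable _ _ _ (range K)); last exact: card_image_le.
by apply: subset_card_le => _ [_ [k ->]]; exists k.
Qed.

(** A minimum is attained: if some acyclic partition is finite, one of least size works; otherwise
    all are infinite and none is smaller than the countable [P]. *)
Lemma countable_dichromatic P : acyclic_partition D P -> countable P ->
  exists K : set (set T), is_dichromatic_number D K /\ countable K.
Proof.
move=> aP cP.
have [fin|nfin] := pselect (exists n Q, acyclic_partition D Q /\ Q #= `I_n).
  have [n [[Q [aQ Qn]] nmin]] := ex_least fin.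
  exists Q; split; last by apply: finite_set_countable; apply/finite_setP; exists n.
  split=> [|Q' aQ']; first by exists Q.
  have [/finite_setP[m Q'm]|/infiniteP infQ'] := pselect (finite_set Q').
    rewrite (card_le_eqr Q'm) (card_le_eql Qn) card_le_II.
    by apply: nmin; exists Q'.
  apply: card_le_trans infQ'; apply: finite_set_countable.
  by apply/finite_setP; exists n.
exists P; split=> //; split=> [|Q aQ]; first by exists P.
apply: (card_le_trans cP); apply/infiniteP => /finite_setP[n Qn].
by apply: nfin; exists n, Q.
Qed.

End Walks.

Theorem theorem3p7 (T : Type) (D : digraph T)
    (D_no_necklace : ~ exists N : digraph T, necklace N /\ subdigraph N D) :
  exists K : set (set T), is_dichromatic_number D K /\ countable K.
Proof.
have [P aP cP] : exists2 P, acyclic_partition D P & countable P.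
  apply: colorable_partition; apply: contrapT => nD.
  exact/D_no_necklace/uncolorable_necklace.
exact: countable_dichromatic aP cP.
Qed.
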